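(* Let $Y$ be a real Banach space with the local diameter 2 property+ (LD2P+), and let $X$ be a (closed) subspace of $Y$ which is an almost isometric ideal (ai-ideal) in $Y$. Then $X$ has the LD2P+.
   Context: For a Banach space $Z$, $B_Z$ and $S_Z$ denote the closed unit ball and the unit sphere, and $Z^*$ the topological dual. For $z^*\in S_{Z^*}$ and $\varepsilon>0$, $S(z^*,\varepsilon)=\{z\in B_Z : z^*(z)>1-\varepsilon\}$. $Z$ has the local diameter 2 property+ (LD2P+) if for every $z^*\in S_{Z^*}$, every $\varepsilon>0$, every $\delta>0$, and every $x\in S(z^*,\varepsilon)\cap S_Z$ there exists $y\in S(z^*,\varepsilon)$ with $\|x-y\|>2-\delta$. A subspace $X$ of a Banach space $Y$ is an almost isometric ideal (ai-ideal) in $Y$ if for every $\varepsilon>0$ and every finite-dimensional subspace $E\subset Y$ there exists a linear map $T:E\to X$ such that $Te=e$ for all $e\in X\cap E$ and $(1-\varepsilon)\|e\|\le\|Te\|\le(1+\varepsilon)\|e\|$ for all $e\in E$. *)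

(* Defs.v *)
From HB Require Import structures.
From mathcomp Require Import all_boot all_order all_algebra.
From mathcomp Require Import all_classical all_reals all_analysis.

Set Implicit Arguments.
Unset Strict Implicit.
Unset Printing Implicit Defensive.

Import Order.TTheory GRing.Theory Num.Theory.
Import numFieldNormedType.Exports.

Local Open Scope classical_set_scope.
Local Open Scope ring_scope.

(* A linear subspace X of Y as a normed space in its own right, with the norm
   of Y. The library's set_type and subspace do not provide this: the former
   has no algebraic structure, the latter keeps the carrier of Y. *)
Record sub_space (R : realType) (Y : normedModType R) (X : submodClosed Y) :=
  SubSpace { sub_val : Y; sub_valP : sub_val \in X }.

Section sub_space_instances.
Context (R : realType) (Y : normedModType R) (X : submodClosed Y).

HB.instance Definition _ := [isSub for @sub_val R Y X].
HB.instance Definition _ := [Choice of sub_space X by <:].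
HB.instance Definition _ := [SubChoice_isSubLmodule of sub_space X by <:].

Definition sub_norm (x : sub_space X) : R := `|val x|.

Lemma sub_normD (x y : sub_space X) : sub_norm (x + y) <= sub_norm x + sub_norm y.
Proof. by rewrite /sub_norm raddfD ler_normD. Qed.

Lemma sub_normZ (l : R) (x : sub_space X) : sub_norm (l *: x) = `|l| * sub_norm x.
Proof. by rewrite /sub_norm linearZ /= normrZ. Qed.

Lemma sub_norm_eq0 (x : sub_space X) : sub_norm x = 0 -> x = 0.
Proof. by move=> /normr0_eq0 x0; apply: val_inj; rewrite x0 raddf0. Qed.

HB.instance Definition _ := Lmodule_isNormed.Build R (sub_space X)
  sub_normD sub_normZ sub_norm_eq0.

End sub_space_instances.

Section LD2P_plus.
Context (R : realType) (Z : normedModType R).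

Definition unit_ball : set Z := [set z | `|z| <= 1].

Definition unit_sphere : set Z := [set z | `|z| = 1].

Definition dual_norm (f : {linear Z -> R^o}) : R :=
  sup [set `|f z| | z in unit_ball].

(* Continuity is required explicitly: sup returns 0 on unbounded sets, so
   dual_norm is only meaningful for continuous functionals. *)
Definition dual_sphere : set {linear Z -> R^o} :=
  [set f : {linear Z -> R^o} | continuous f /\ dual_norm f = 1].

Definition slice (f : {linear Z -> R^o}) (eps : R) : set Z :=
  [set z | unit_ball z /\ 1 - eps < f z].

Definition LD2P_plus : Prop :=
  forall f : {linear Z -> R^o}, dual_sphere f ->
  forall eps : R, 0 < eps -> forall delta : R, 0 < delta ->
  forall x : Z, (slice f eps `&` unit_sphere) x ->
  exists y : Z, slice f eps y /\ 2 - delta < `|x - y|.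

End LD2P_plus.

Arguments LD2P_plus {R} Z.

Section ai_ideal.
Context (R : realType) (Y : normedModType R).

Definition finite_dimensional (E : submodClosed Y) : Prop :=
  exists s : seq Y, forall y : Y, y \in E <->
    exists c : 'I_(size s) -> R, y = \sum_(i < size s) c i *: s`_i.

Definition ai_ideal (X : submodClosed Y) : Prop :=
  forall eps : R, 0 < eps ->
  forall E : submodClosed Y, finite_dimensional E ->
  exists T : {linear sub_space E -> sub_space X},
    (forall e : sub_space E, val e \in X -> val (T e) = val e) /\
    (forall e : sub_space E,
       (1 - eps) * `|e| <= `|T e| /\ `|T e| <= (1 + eps) * `|e|).

End ai_ideal.

(* Main.v *)
(* Limits, along an ultrafilter, of the compositions of [f] with the almost
   isometries [T : E -> X] define a norm-preserving extension [F] of [f] to [Y]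
   (no appeal to Hahn-Banach). The LD2P+ of [Y], applied to [F], yields [y] in
   the slice of [F] far from [x]; as [F y] is a limit of the values [f (T y)],
   some [T] with small distortion has [f (T y)] still above the level of the
   slice, and a slight rescaling of [T y] is the required point of [X]. *)
Require Import Defs.
From HB Require Import structures.
From mathcomp Require Import all_boot all_order all_algebra.
From mathcomp Require Import all_classical all_reals all_analysis.
From mathcomp Require Import lra.

Import Order.TTheory GRing.Theory Num.Theory.
Import numFieldNormedType.Exports.

Local Open Scope classical_set_scope.
Local Open Scope ring_scope.

(** Compactness of [[-M, M]] gives the image filter a cluster point [p]. A neighbourhood of [p]
    outside the image would have its complement in it, by maximality, and this complement misses the
    neighbourhood. *)
Lemma ultra_bounded_cvg {R : realType} {T : Type} {U : set_system T}
    {M : R} {h : T -> R} :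
  UltraFilter U -> (\forall t \near U, `|h t| <= M) -> cvg (h @ U).
Proof.
move=> UU hM.
have [|p [_ Up]] := @segment_compact R (- M) M (h @ U) _.
  by apply: filterS hM => t /=; rewrite in_itv /= ler_norml.
apply/cvg_ex; exists p => A Ap.
have [//|UnA] := in_ultra_setVsetC (h @^-1` A) UU.
by have [q []] := Up (~` A) A UnA Ap.
Qed.

Section dual_norm.
Context {R : realType} {Z : normedModType R}.
Implicit Types f : {linear Z -> R^o}.

(** Continuity bounds the set whose [sup] is [dual_norm f], so this [sup] is a genuine upper bound,
    applied to the normalised vector. *)
Lemma dual_sphere_le f z : dual_sphere f -> `|f z| <= `|z|.
Proof.
move=> [/linear_bounded_continuous/linear_boundedP fb f1].
have [r /= fr] : exists r, forall x, `|f x| <= r * `|x|.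
  by have [r] := filter_ex fb; exists r.
have fub : has_ubound [set `|f z| | z in @unit_ball _ Z].
  exists `|r| => _ [x /= x1 <-]; rewrite (le_trans (fr x))//.
  by rewrite (le_trans (ler_norm _))// normrM normr_id ler_piMr.
have [->|z0] := eqVneq z 0; first by rewrite linear0 !normr0.
have nz : 0 < `|z| by rewrite normr_gt0.
have := ub_le_sup fub (x := `|f (`|z|^-1 *: z)|).
rewrite -/(dual_norm f) f1 linearZ /= normrM normfV normr_id.
rewrite ler_pdivrMl// mulr1; apply; exists (`|z|^-1 *: z).
  by rewrite /unit_ball/= normrZ normfV normr_id mulVf ?gt_eqF.
by rewrite linearZ /= normrM normfV normr_id.
Qed.

Lemma dual_norm_le1 f : (forall z, `|f z| <= `|z|) ->
  continuous f /\ dual_norm f <= 1.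
Proof.
move=> fle; split.
  apply/linear_bounded_continuous/linear_boundedP.
  exists 1; split=> // r r1 z; rewrite (le_trans (fle z))// ler_peMl//.
  exact: ltW.
apply: ge_sup => [|_ [z z1 <-]]; last exact: le_trans z1.
by exists `|f 0|, 0 => //; rewrite /unit_ball/= normr0.
Qed.

End dual_norm.

Section lin_span.
Context {R : realType} {Y : normedModType R} (s : seq Y).

Definition lin_span : {pred Y} := fun y =>
  `[< exists c : 'I_(size s) -> R, y = \sum_(i < size s) c i *: s`_i >].

Lemma lin_span_submod_closed : GRing.submod_closed lin_span.
Proof.
split=> [|a u v /asboolP[c ->] /asboolP[d ->]]; apply/asboolP.
  by exists (fun=> 0); rewrite big1// => i _; rewrite scale0r.
exists (fun i => a * c i + d i); rewrite scaler_sumr -big_split/=.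
by apply: eq_bigr => i _; rewrite scalerDl scalerA.
Qed.

HB.instance Definition _ :=
  GRing.isSubmodClosed.Build R Y lin_span lin_span_submod_closed.

Lemma lin_span_finite_dimensional : finite_dimensional lin_span.
Proof. by exists s => y; split=> /asboolP. Qed.

Lemma mem_lin_span : {subset s <= lin_span}.
Proof.
move=> y ys; have ys' : (index y s < size s)%N by rewrite index_mem.
apply/asboolP; exists (fun i => (i == Ordinal ys')%:R).
rewrite (bigD1 (Ordinal ys'))//= eqxx scale1r nth_index// big1 ?addr0//.
by move=> i /negbTE ->; rewrite scale0r.
Qed.

End lin_span.

Section extension.
Context {R : realType} {Y : normedModType R} {X : submodClosed Y}.

(* Total functions, so that maps with different domains [E] live in one type on
   which a filter can be put; their values outside [E] are irrelevant. *)
Definition local_isometries (s : seq Y) (eps : R) : set (Y -> sub_space X) :=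
  [set g | exists E : submodClosed Y, {subset s <= E} /\
    exists T : {linear sub_space E -> sub_space X},
    [/\ forall e, g (val e) = T e,
        forall e, val e \in X -> val (T e) = val e &
        forall e, (1 - eps) * `|e| <= `|T e| /\ `|T e| <= (1 + eps) * `|e|]].

Lemma local_isometriesS s s' eps eps' : {subset s <= s'} -> eps' <= eps ->
  local_isometries s' eps' `<=` local_isometries s eps.
Proof.
move=> ss' ee' g [E [s'E [T [gT TX Te]]]]; exists E; split.
  by move=> y /ss'/s'E.
exists T; split=> // e; have [Te1 Te2] := Te e.
split; [apply: le_trans Te1|apply: le_trans Te2 _];
  by rewrite ler_wpM2r// ?lerD2l ?lerN2.
Qed.

Lemma local_isometries_nonempty s eps : ai_ideal X -> 0 < eps ->
  local_isometries s eps !=set0.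
Proof.
move=> aiX e0.
have [T [TX Te]] := aiX _ e0 _ (lin_span_finite_dimensional s).
(* [T] is extended by [0] off the span. *)
exists (fun y => odflt 0 (omap T (insub y))), (lin_span s : submodClosed Y).
split; first exact: mem_lin_span.
by exists T; split=> // e; rewrite valK.
Qed.

Section local_isometries_lemmas.
Context {s : seq Y} {eps : R} {g : Y -> sub_space X}.
Hypothesis gs : local_isometries s eps g.

(** The domain [E] is a subspace containing [s], so [a *: u + v] lies in it without being listed in
    [s]. *)
Lemma local_isometries_linear a u v : u \in s -> v \in s ->
  g (a *: u + v) = a *: g u + g v.
Proof.
case: gs => E [sE [T [gT _ _]]] /sE uE /sE vE.
by rewrite -[u]/(val (SubSpace uE)) -[v]/(val (SubSpace vE)) -linearP !gT linearP.
Qed.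

Lemma local_isometries_id x : val x \in s -> g (val x) = x.
Proof.
case: gs => E [sE [T [gT TX _]]] /sE xE; apply: val_inj.
by rewrite (gT (SubSpace xE)) TX//; exact: (valP x).
Qed.

Lemma local_isometries_norm u : u \in s ->
  (1 - eps) * `|u| <= `|g u| /\ `|g u| <= (1 + eps) * `|u|.
Proof.
case: gs => E [sE [T [gT _ Te]]] /sE uE.
by rewrite (gT (SubSpace uE)); exact: (Te (SubSpace uE)).
Qed.

Lemma local_isometries_dist u v : u \in s -> v \in s ->
  (1 - eps) * `|u - v| <= `|g u - g v|.
Proof.
case: gs => E [sE [T [gT _ Te]]] /sE uE /sE vE.
rewrite (gT (SubSpace uE)) (gT (SubSpace vE)) -linearB.
exact: (Te (SubSpace uE - SubSpace vE)).1.
Qed.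

End local_isometries_lemmas.

(** The sets [local_isometries s eps] form a filter base of nonempty sets: concatenating the lists
    and taking the smaller tolerance gives a set inside both. *)
Lemma local_isometries_ultrafilter : ai_ideal X ->
  exists U : set_system (Y -> sub_space X), UltraFilter U /\
    forall s eps, 0 < eps -> U (local_isometries s eps).
Proof.
move=> aiX.
set B := fun p : seq Y * R => local_isometries p.1 p.2.
have FB : ProperFilter (filter_from [set p | 0 < p.2] B).
  apply: filter_from_proper => [|[s e] e0]; last first.
    exact: local_isometries_nonempty.
  apply: filter_from_filter; first by exists ([::], 1) => /=.
  move=> [s e] [s' e'] /= e0 e'0; exists (s ++ s', Num.min e e').
    by rewrite /= lt_min e0.
  move=> g Bg; split; apply: local_isometriesS Bg => /=.
  - by move=> y ys; rewrite mem_cat ys.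
  - by rewrite ge_min lexx.
  - by move=> y ys; rewrite mem_cat ys orbT.
  - by rewrite ge_min lexx orbT.
have [U [UU BU]] := ultraFilterLemma FB.
by exists U; split=> // s e e0; apply: BU; exists (s, e).
Qed.

(** The third clause is what later arguments need of the convergence of [f (g y)] to [F y]: one [g]
    that is almost isometric on [s] and almost attains [F y] from below. *)
Lemma ai_ideal_extension (f : {linear sub_space X -> R^o}) :
  ai_ideal X -> dual_sphere f ->
  exists F : {linear Y -> R^o}, [/\ dual_sphere F,
    forall x, F (val x) = f x &
    forall s eps y b, 0 < eps -> b < F y ->
      exists g, local_isometries s eps g /\ b < f (g y)].
Proof.
move=> aiX fS; have fle z := dual_sphere_le f z fS.
have [U [UU Ubase]] := local_isometries_ultrafilter aiX.
have Ule y eps : 0 < eps ->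
    \forall g \near U, `|f (g y)| <= (1 + eps) * `|y|.
  move=> e0; apply: filterS (Ubase [:: y] eps e0) => g gy.
  apply: le_trans (fle _) _.
  by have [] := local_isometries_norm gy y (mem_head _ _).
pose F y : R^o := lim (f (g y) @[g --> U]).
have FU y : f (g y) @[g --> U] --> F y.
  exact: (ultra_bounded_cvg UU (Ule y 1 ltr01)).
have Flin : linear F.
  move=> a u v; apply: cvg_lim => //.
  have lim_uv : (a *: f (g u) + f (g v) : R^o) @[g --> U] --> a *: F u + F v.
    by apply: cvgD => //; apply: cvgZl_tmp.
  apply: (cvg_trans _ lim_uv).
  apply: near_eq_cvg.
  (* Linearity of [g] on [u] and [v] is exact whatever the tolerance, hence the arbitrary [1]. *)
  apply: filterS (Ubase [:: u; v] 1 ltr01) => g guv /=.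
  by rewrite (local_isometries_linear guv a u v) ?linearP// !inE eqxx ?orbT.
pose FL : {linear Y -> R^o} :=
  HB.pack F (GRing.isLinear.Build R Y R^o _ F Flin).
have Fext x : FL (val x) = f x.
  apply: cvg_lim => //; have lim_x : f x @[_ --> U] --> f x by exact: cvg_cst.
  apply: (cvg_trans _ lim_x).
  apply: near_eq_cvg.
  apply: filterS (Ubase [:: val x] 1 ltr01) => g gx /=.
  by rewrite (local_isometries_id gx) ?mem_head.
have Fle y : `|FL y| <= `|y|.
  apply/ler_addgt0Pr => e e0.
  (* With this tolerance the excess over [|y|] is at most [e]; the [+ 1] covers [y = 0]. *)
  have d0 : 0 < e / (`|y| + 1) by rewrite divr_gt0// ltr_wpDl.
  have : F y \in `[- ((1 + e / (`|y| + 1)) * `|y|), (1 + e / (`|y| + 1)) * `|y|].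
    apply: (closed_cvg (fun r => r \in `[_, _])) (FU y) => //.
      exact: interval_closed.
    by apply: filterS (Ule y _ d0) => g; rewrite in_itv /= ler_norml.
  rewrite in_itv /= -ler_norml => /le_trans; apply.
  rewrite mulrDl mul1r lerD2l -mulrA ler_piMr ?(ltW e0)//.
  by rewrite mulrC ler_pdivrMr ?mul1r ?lerDl ?ltr_wpDl.
exists FL; split=> //.
  have [Fc F1] := dual_norm_le1 FL Fle; split=> //.
  (* The unit ball of [X] lies in that of [Y] and [F] extends [f], so the norm of [F] is at least
     that of [f]. *)
  apply/eqP; rewrite eq_le F1 /= -(proj2 fS) /dual_norm.
  apply: le_sup => [_ [x x1 <-]| |].
  - by apply/downP; exists `|f x| => //; exists (val x); rewrite ?Fext.
  - by exists `|f 0|, 0 => //; rewrite /unit_ball/= normr0.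
  - split; first by exists `|FL 0|, 0 => //; rewrite /unit_ball/= normr0.
    by exists 1 => _ [y y1 <-]; exact: le_trans y1.
move=> s eps y b e0 bF.
have [g [gs bg]] := filter_ex (filterI (Ubase s eps e0) (cvgr_gt _ (FU y) b bF)).
by exists g.
Qed.

End extension.

Theorem proposition3p8 (R : realType) (Y : completeNormedModType R)
  (X : submodClosed Y) (X_closed : closed [set` X])
  (Y_LD2P_plus : LD2P_plus Y) (X_ai_ideal : ai_ideal X) :
  LD2P_plus (sub_space X).
Proof.
move=> f fS eps eps0 delta delta0 x [[_ fx] x1].
have [F [FS Fext Fapprox]] := ai_ideal_extension f X_ai_ideal fS.
have [|y [[y1 Fy] xy]] := Y_LD2P_plus F FS eps eps0 delta delta0 (val x).
  by split=> //; split; rewrite /unit_ball/= ?Fext// -[`|val x|]/(`|x|) x1.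
have xy2 : `|val x - y| <= 2.
  by rewrite (le_trans (ler_normB _ _))// -[`|val x|]/(`|x|) x1 lerD.
(* As [eta <= 1], both [|g y|] and [f (g y)] are at most 2. The slice value loses at most [3 * eta]:
   [eta] by approximation, [2 * eta] by rescaling. The distance loses at most [4 * eta]: [2 * eta]
   by distortion, [2 * eta] by rescaling. Dividing by 4 and 5 keeps both inequalities strict. *)
pose eta := Num.min 1 (Num.min ((F y - (1 - eps)) / 4)
  ((`|val x - y| - (2 - delta)) / 5)).
have eta0 : 0 < eta by rewrite !lt_min ltr01 !divr_gt0 ?subr_gt0.
have [eta1 etaF etad] : [/\ eta <= 1, eta <= (F y - (1 - eps)) / 4 &
    eta <= (`|val x - y| - (2 - delta)) / 5].
  by rewrite !ge_min !lexx ?orbT.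
(* Listing [val x] makes [g] fix it, so distances are measured from [x] itself. *)
have [|g [gs fgy]] := Fapprox [:: val x; y] eta y (F y - eta) eta0; first by lra.
have xs : val x \in [:: val x; y] by rewrite mem_head.
have ys : y \in [:: val x; y] by rewrite !inE eqxx orbT.
have [_ gyle] := local_isometries_norm gs y ys.
have := local_isometries_dist gs (val x) y xs ys.
rewrite (local_isometries_id gs)// => dist.
have gy1 : `|g y| <= 1 + eta.
  by apply: le_trans gyle _; rewrite ler_piMr//; lra.
have fgyle : f (g y) <= `|g y| := le_trans (ler_norm _) (dual_sphere_le f _ fS).
(* The factor [1 - eta] returns [g y] to the unit ball, since [(1 - eta) * (1 + eta) <= 1]. *)
exists ((1 - eta) *: g y); split; first split.
- rewrite /unit_ball/= normrZ ger0_norm ?subr_ge0//.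
  by apply: (@le_trans _ _ ((1 - eta) * (1 + eta))); [rewrite ler_wpM2l; lra|nra].
- by rewrite linearZ /= /GRing.scale /=; nra.
- have := ler_normB (x - (1 - eta) *: g y) (eta *: g y).
  rewrite -addrA -opprD -scalerDl subrK scale1r normrZ gtr0_norm//.
  by move=> tri; nra.
Qed.
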